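(* Let $n$ be an odd integer and $k$ an integer with $1\le k\le n-1$. For each positive divisor $d$ of $n$, let $\alpha_d^{k}$ (resp. $\gamma_d^{k}$) be the number of $\sigma$-orbits contained in $E_{\rm e}^{-}(n,k)$ (resp. $E_{\rm o}^{-}(n,k)$) whose period equals $d(n-k)$. (i) If a positive divisor $d$ of $n$ satisfies $\gcd(k,n/d)>1$, then $\alpha_d^{k}=\gamma_d^{k}=0$. (ii) If $\gcd(k,n)=1$, then $\alpha_1^{k}=\epsilon_n^{n-k}$ and $\gamma_1^{k}=1-\epsilon_n^{n-k}$.
   Context: Permutations of $[n]=\{1,\dots,n\}$ are written as words $a_1a_2\cdots a_n$. An ascent is an index $i$ ($1\le i\le n-1$) with $a_i<a_{i+1}$. An inversion is a pair $(i,j)$ with $1\le i<j\le n$ and $a_i>a_j$. $E(n,k)$ is the set of permutations of $[n]$ with exactly $k$ ascents; $E_{\rm e}(n,k)$, $E_{\rm o}(n,k)$ are its subsets of permutations with an even, respectively odd, number of inversions; $E_{\rm e}^{-}(n,k)$, $E_{\rm o}^{-}(n,k)$ are the permutations $a_1\cdots a_n$ in these sets with $a_1<a_n$. The operator $\sigma$ on permutations $A=a_1\cdots a_n$ of $[n]$: if $a_i=n$ for some $2\le i\le n-1$, then $\sigma(A)=b_1\cdots b_n$ with $b_j=a_j+1$ for $j\ne i$ and $b_i=1$; if $a_n=n$, then $\sigma(A)=1(a_1+1)\cdots(a_{n-1}+1)$; if $a_1=n$, then $\sigma(A)=(a_2+1)\cdots(a_n+1)1$. $\sigma$ is a bijection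 on permutations of $[n]$; the period of $A$ is the least $\ell\ge1$ with $\sigma^{\ell}A=A$, and the orbit of $A$ is $\{\sigma^jA: j\ge1\}$. For odd $n$, $\sigma$ maps $E_{\rm e}^{-}(n,k)$ and $E_{\rm o}^{-}(n,k)$ into themselves, so these are unions of orbits. For a positive integer $\ell$ with $\gcd(\ell,n)=1$, $P_n^{\ell}$ is the permutation $c_0c_1\cdots c_{n-1}$ of $[n]$ where $c_j\in[n]$ is the unique element with $c_j\equiv 1+j\ell \pmod n$; $\epsilon_n^{\ell}=1$ if $P_n^{\ell}$ has an even number of inversions and $\epsilon_n^{\ell}=0$ otherwise. *)

(* Defs.v *)
From mathcomp Require Import all_boot fingroup perm.

Set Implicit Arguments.
Unset Strict Implicit.
Unset Printing Implicit Defensive.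

(* A permutation of [n] is an element A of 'S_n.  Since 'I_n = {0, ..., n-1},
   positions and values are shifted by one: the letter a_(i+1) of the word of
   A is (A i).+1. *)
Definition word n (A : 'S_n) : seq nat := [seq (A i).+1 | i <- enum 'I_n].

Definition ascents (w : seq nat) : nat :=
  #|[set i : 'I_(size w).-1 | nth 0 w i < nth 0 w i.+1]|.

Definition inversions (w : seq nat) : nat :=
  #|[set p : 'I_(size w) * 'I_(size w) |
      (p.1 < p.2) && (nth 0 w p.1 > nth 0 w p.2)]|.

Definition E n k : {set 'S_n} := [set A | ascents (word A) == k].
Definition E_e n k : {set 'S_n} := [set A in E n k | ~~ odd (inversions (word A))].
Definition E_o n k : {set 'S_n} := [set A in E n k | odd (inversions (word A))].
Definition E_e_minus n k : {set 'S_n} :=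
  [set A in E_e n k | head 0 (word A) < last 0 (word A)].
Definition E_o_minus n k : {set 'S_n} :=
  [set A in E_o n k | head 0 (word A) < last 0 (word A)].

(* In each of the three cases, sigma increases every letter cyclically (the
   letter n becomes 1), after a cyclic shift of the positions when n is the
   last or the first letter; [word_sigma] below gives the effect on words. *)
Definition sigma_fun n (A : 'S_n) (j : 'I_n) : 'I_n :=
  ordS (A (if last 0 (word A) == n then ord_pred j
           else if head 0 (word A) == n then ordS j
           else j)).

Lemma sigma_fun_inj n (A : 'S_n) : injective (sigma_fun A).
Proof.
move=> i j /ordS_inj /perm_inj.
case: ifP => _; first exact: ord_pred_inj.
by case: ifP => _ //; exact: ordS_inj.
Qed.

Definition sigma n (A : 'S_n) : 'S_n := perm (@sigma_fun_inj n A).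

Definition sigma_word n (w : seq nat) : seq nat :=
  if last 0 w == n then 1 :: [seq a.+1 | a <- take n.-1 w]
  else if head 0 w == n then rcons [seq a.+1 | a <- behead w] 1
  else [seq if a == n then 1 else a.+1 | a <- w].

Lemma size_word n (A : 'S_n) : size (word A) = n.
Proof. by rewrite size_map size_enum_ord. Qed.

Lemma nth_word n (A : 'S_n) (i : 'I_n) : nth 0 (word A) i = (A i).+1.
Proof. by rewrite (nth_map i) ?size_enum_ord // nth_ord_enum. Qed.

Lemma word_sigma n (A : 'S_n) : 0 < n -> word (sigma A) = sigma_word n (word A).
Proof.
case: n A => [//|n] A _.
have sw := size_word A.
have szw : size (sigma_word n.+1 (word A)) = n.+1.
  rewrite /sigma_word; case: ifP => _.
    by rewrite /= size_map size_takel ?sw.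
  by case: ifP => _; rewrite ?size_rcons size_map ?size_behead sw.
apply: (@eq_from_nth _ 0); first by rewrite szw size_word.
move=> i; rewrite size_word => ltin.
rewrite -[i]/(nat_of_ord (Ordinal ltin)); set j := Ordinal ltin.
rewrite nth_word permE /sigma_fun /sigma_word.
have ordSE (x : 'I_n.+1) : ((ordS x) : nat).+1 = if x.+1 == n.+1 then 1 else x.+2.
  rewrite /=; case: eqP => [->|/eqP ne]; first by rewrite modnn.
  by rewrite modn_small // ltn_neqAle ne ltn_ord.
rewrite ordSE.
case: (eqVneq (last 0 (word A)) n.+1) => [lastn|_].
  have Amax : (A ord_max).+1 = n.+1.
    by rewrite -(nth_word A ord_max); move: lastn; rewrite -nth_last sw.
  rewrite /j; case: i {j} ltin => [|i] ltin; set j := Ordinal ltin.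
    have -> : ord_pred j = ord_max.
      by apply: val_inj; rewrite /= modn_small.
    by rewrite Amax eqxx.
  have lti : i < n.+1 by apply: ltnW.
  have -> : ord_pred j = Ordinal lti.
    by apply: val_inj; rewrite /= modnDr modn_small.
  have -> /= : ((A (Ordinal lti)).+1 == n.+1) = false.
    apply/eqP=> e1; have [/val_inj /perm_inj /(congr1 val) /= e] := etrans e1 (esym Amax).
    by have := ltin; rewrite e ltnn.
  rewrite (nth_map 0) ?size_takel ?sw // nth_take //.
  by rewrite -(nth_word A (Ordinal lti)).
case: (eqVneq (head 0 (word A)) n.+1) => [headn|_].
  have A0 : (A ord0).+1 = n.+1 by rewrite -(nth_word A ord0); move: headn; rewrite -nth0.
  rewrite nth_rcons size_map size_behead sw /=.
  case: (ltnP i n) => lein.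
    have lti : i.+1 < n.+1 by [].
    have -> : ordS j = Ordinal lti by apply: val_inj; rewrite /= modn_small.
    have -> : ((A (Ordinal lti)).+1 == n.+1) = false.
      apply/eqP=> e1; have [/val_inj /perm_inj /(congr1 val) /= e] := etrans e1 (esym A0).
      by [].
    rewrite (nth_map 0) ?size_behead ?sw // nth_behead.
    by rewrite -(nth_word A (Ordinal lti)).
  have ei : i = n by apply/eqP; rewrite eqn_leq lein -ltnS ltin.
  have -> : ordS j = ord0 by apply: val_inj; rewrite /= ei modnn.
  by rewrite A0 eqxx ei eqxx.
by rewrite (nth_map 0) ?sw // nth_word.
Qed.

(* The list [orbit sigma B] starts at B; started at [sigma A] it enumerates
   the sigma^j A with j >= 1. *)
Definition sigma_orbit n (A : 'S_n) : {set 'S_n} :=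
  [set B in orbit (@sigma n) (sigma A)].

Lemma sigma_orbitP n (A B : 'S_n) :
  reflect (exists2 j, 0 < j & B = iter j (@sigma n) A) (B \in sigma_orbit A).
Proof.
rewrite inE -fconnect_orbit; apply: (iffP idP) => [/iter_findex <-|[[|j] // _ ->]].
  by exists (findex (@sigma n) (sigma A) B).+1 => //; rewrite iterSr.
by rewrite iterSr fconnect_iter.
Qed.

Definition has_period n (A : 'S_n) (l : nat) : bool :=
  [&& 0 < l, iter l (@sigma n) A == A
    & [forall m : 'I_l, (0 < m) ==> (iter m (@sigma n) A != A)]].

Definition num_orbits n (S : {set 'S_n}) (l : nat) : nat :=
  #|[set O in [set sigma_orbit A | A : 'S_n] |
      (O \subset S) && [forall A in O, has_period A l]]|.

Definition alpha n k d : nat := num_orbits (E_e_minus n k) (d * (n - k)).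
Definition gamma n k d : nat := num_orbits (E_o_minus n k) (d * (n - k)).

Definition P_letter n l j : nat := (j * l %% n).+1.

Lemma P_letterP n l j c : 0 < n ->
  (c == P_letter n l j) = [&& 1 <= c, c <= n & c == 1 + j * l %[mod n]].
Proof.
move=> n0; case: c => [//|c]; rewrite /P_letter eqSS /= add1n.
rewrite -[c.+1]addn1 -[(j * l).+1]addn1 eqn_modDr addn1.
apply/eqP/andP => [->|[ltc /eqP <-]]; last by rewrite modn_small.
by rewrite ltn_mod n0 modn_mod.
Qed.

Definition P_word n l : seq nat := [seq P_letter n l j | j <- iota 0 n].

Definition epsilon n l : nat := if odd (inversions (P_word n l)) then 0 else 1.

(* Main.v *)
(* For a permutation A with k ascents and a_1 < a_n, let C(A) be the sum of n -
   i over the ascents i of A; it is [bit_weight (ascent_bits (word A))]. One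
   application of sigma adds 1 modulo n to all letters, rotates the
   positions by one place exactly when a_n = n, and changes C by -1, plus n
   - k if it rotated. Hence if sigma^l A = A and m rotations occur in these
   l steps, then l = m (n - k) and a_(j+m) = a_j + m (n - k) modulo n. For l
   = d (n - k) this gives m = d, and if g = gcd(k, n/d) > 1, iterating
   (n/d)/g times contradicts the injectivity of A. For d = 1 it forces A to
   be a translate of P_n^(n-k), and the n - k translates with a_1 < a_n form
   a single orbit. The parity of the number of inversions is constant on it:
   a rotating step preserves this number, any other step replaces n by 1 at
   some position i, which trades the n - i inversions involving n for i - 1
   involving 1, and n - 1 is even. *)
Require Import Defs.
From mathcomp Require Import all_boot fingroup perm.
From mathcomp Require Import zify.

Set Implicit Arguments.
Unset Strict Implicit.
Unset Printing Implicit Defensive.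

(** * Ascents, inversions and the weight of a word *)

Definition ascent_bits (w : seq nat) : bitseq :=
  if w is x :: s then pairmap ltn x s else [::].

(** A set bit weighs the length of the suffix it starts, so an ascent [i] of a word of length [n]
    weighs [n - i]. *)
Fixpoint bit_weight (b : bitseq) : nat :=
  if b is x :: b' then x * size b + bit_weight b' else 0.

Lemma bit_weight_cat b1 b2 :
  bit_weight (b1 ++ b2) = bit_weight b1 + count id b1 * size b2 + bit_weight b2.
Proof.
elim: b1 => //= x b1 ->; rewrite size_cat; case: x => /=; lia.
Qed.

Lemma pairmap_ltn_succ x s :
  pairmap ltn x.+1 [seq a.+1 | a <- s] = pairmap ltn x s.
Proof. by elim: s x => //= y s IH x; rewrite IH. Qed.

Lemma ascentsE w : ascents w = count id (ascent_bits w).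
Proof.
case: w => [|x s]; first by apply: eq_card0 => -[].
rewrite /ascents cardsE -sum1_card big_mkcond /=.
elim: s x => [|y s IH] x; first by rewrite big_ord0.
by rewrite big_ord_recl /= -IH; congr (_ + _); apply: eq_bigr => i _.
Qed.

Lemma inversions_cons x s :
  inversions (x :: s) = count (fun y => y < x) s + inversions s.
Proof.
have invE w : inversions w = \sum_(i < size w) \sum_(j < size w)
    ((i < j) && (nth 0 w j < nth 0 w i)).
  rewrite /inversions cardsE -sum1_card big_mkcond pair_bigA /=.
  by apply: eq_bigr => -[i j] _; rewrite unfold_in /=; case: (_ && _).
rewrite !invE /= big_ord_recl; congr (_ + _).
  rewrite big_ord_recl /= add0n -sum1_count big_mkcond (big_nth 0) big_mkord.
  by rewrite [RHS]big_mkcond; apply: eq_bigr => i _; rewrite add0n; case: ifP.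
by apply: eq_bigr => i _; rewrite big_ord_recl.
Qed.

Lemma inversions_succ s : inversions [seq a.+1 | a <- s] = inversions s.
Proof.
elim: s => //= x s IH; rewrite !inversions_cons IH count_map.
by congr (_ + _); apply: eq_count.
Qed.

Lemma inversions_insert_max m u v : all (fun a => a < m) (u ++ v) ->
  inversions (u ++ m :: v) = inversions (u ++ v) + size v.
Proof.
elim: u => [|x u IH] /=.
  by rewrite inversions_cons all_count => /eqP ->; rewrite addnC.
case/andP=> ltx /IH e; rewrite !inversions_cons {}e !count_cat /=; lia.
Qed.

Lemma inversions_insert_min m u v : all (fun a => m < a) (u ++ v) ->
  inversions (u ++ m :: v) = inversions (u ++ v) + size u.
Proof.
elim: u => [|x u IH] /=.
  rewrite inversions_cons addn0 => /allP h.
  rewrite (eq_in_count (a2 := pred0)) ?count_pred0 // => y /h /=; lia.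
case/andP=> ltx /IH e; rewrite !inversions_cons {}e !count_cat /=; lia.
Qed.

(** * The effect of one step of [sigma] *)

Lemma word_split n (A : 'S_n) : 0 < n -> exists u v,
  [/\ word A = u ++ n :: v, all (fun a => 0 < a < n) (u ++ v)
    & (size u + size v).+1 = n].
Proof.
case: n A => [//|n] A _.
have memn : n.+1 \in word A.
  by apply/mapP; exists (A^-1 ord_max)%g; rewrite ?mem_enum ?permKV.
have uniqw : uniq (word A).
  by rewrite map_inj_uniq ?enum_uniq // => i j [/val_inj /perm_inj].
have bnd : all (fun a => 0 < a <= n.+1) (word A).
  by apply/allP => _ /mapP[i _ ->]; exact: ltn_ord.
have := size_word A; case/splitPr: memn uniqw bnd => u v.
rewrite uniq_catC cat_cons cons_uniq => /andP[nvu _] bnd sz.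
exists u, v; split=> //; last by move: sz; rewrite size_cat /=; lia.
apply/allP => a auv; have /andP[a0 lea] : 0 < a <= n.+1.
  move/allP: bnd; apply; move: auv.
  by rewrite !mem_cat inE => /orP[] ->; rewrite ?orbT.
rewrite a0 ltn_neqAle lea andbT.
by apply: contra nvu => /eqP <-; rewrite mem_cat orbC -mem_cat.
Qed.

Lemma all_last T (p : pred T) x s : p x -> all p s -> p (last x s).
Proof. by elim: s x => //= y s IH x _ /andP[]; apply: IH. Qed.

(** A first letter below the last cannot be [n], so two cases of [sigma] remain: [v] empty is the
    rotating step, otherwise [n] becomes 1 in place. *)
Lemma word_sigma_split n (A : 'S_n) :
    head 0 (word A) < last 0 (word A) -> exists x u v,
  [/\ word A = x :: u ++ n :: v, (size u + size v).+2 = n,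
      (last 0 (word A) == n) = (v == [::]),
      all (fun a => 0 < a < n) (x :: u ++ v)
    & word (sigma A) =
      if v is [::] then 1 :: [seq a.+1 | a <- x :: u]
      else [seq a.+1 | a <- x :: u] ++ 1 :: [seq a.+1 | a <- v]].
Proof.
case: n A => [|n] A.
  by move: (size_word A); case: (word A).
move=> hl; have [u [v [ew bnd sz]]] := word_split A (ltn0Sn n).
rewrite word_sigma // /sigma_word.
case: u ew bnd sz => [|x u] ew bnd sz.
  move: hl; rewrite ew /= ltnNge (all_last (p := fun a => a <= n.+1)) //.
  by apply: sub_all bnd => a /= /andP[_ /ltnW].
have Smap s : all (fun a => 0 < a < n.+1) s ->
    [seq (if a == n.+1 then 1 else a.+1) | a <- s] = [seq a.+1 | a <- s].
  move=> /allP lt; apply/eq_in_map => a /lt.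
  by case: eqP => // ->; rewrite ltnn andbF.
exists x, u, v; rewrite ew; move: (bnd); rewrite /= all_cat => /and3P[bx bu bv].
have elast : (last 0 (x :: u ++ n.+1 :: v) == n.+1) = (v == [::]).
  rewrite /= last_cat /=; case: v {sz bnd ew} bv => [_|y v /= /andP[by_ bv]].
    by rewrite !eqxx.
  by case/andP: (all_last (p := fun a => 0 < a < n.+1) by_ bv) => _ /ltn_eqF ->.
split=> //=; first by rewrite bx bu.
have /andP[_ ltx] := bx.
rewrite [LHS](congr1 (fun b : bool => if b then _ else _) elast) (ltn_eqF ltx).
case: v ew sz {elast bnd} bv => [|y v] ew sz bv /=.
  by rewrite -cat_cons take_size_cat //=; move: sz => /=; lia.
by have /= ev := Smap _ bv; rewrite map_cat /= eqxx ev Smap.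
Qed.

(** Without rotation, the ascent into [n] becomes the ascent out of 1, one place further right. With
    rotation, the final ascent of weight 1 is lost, the other [k - 1] each lose 1, and a new first
    ascent brings [n - 1]. *)
Lemma sigma_step n k (A : 'S_n) :
    ascents (word A) = k -> head 0 (word A) < last 0 (word A) ->
  [/\ ascents (word (sigma A)) = k,
      head 0 (word (sigma A)) < last 0 (word (sigma A))
    & (bit_weight (ascent_bits (word (sigma A)))).+1 =
      bit_weight (ascent_bits (word A)) + (last 0 (word A) == n) * (n - k)].
Proof.
move=> asc hl; have [x [u [v [ew sz -> /= /andP[bx buv] ->]]]] := word_sigma_split hl.
move: asc hl; rewrite {}ew.
have last_succ z s : last z.+1 [seq a.+1 | a <- s] = (last z s).+1 by rewrite last_map.
move: buv; rewrite all_cat !ascentsE => /andP[bu bv].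
have := count_size id (pairmap ltn x u); rewrite size_pairmap => asc_le.
have blast := all_last (p := fun a => 0 < a < n) bx bu; have /andP[_ ltlast] := blast.
case: v sz bv => [|y v] /= sz => [_|/andP[yb _]];
  rewrite ?pairmap_cat /= ?pairmap_ltn_succ !last_cat /= !last_succ ltlast;
  rewrite !count_cat !bit_weight_cat /= ?size_pairmap ?size_map.
  have -> : 1 < x.+1 by lia.
  by move=> asc hl; split; lia.
have -> : n < y = false by lia.
have -> : 1 < y.+1 by lia.
by move=> /= asc hl; split; lia.
Qed.

Lemma odd_inversions_sigma n (A : 'S_n) :
    odd n -> head 0 (word A) < last 0 (word A) ->
  odd (inversions (word (sigma A))) = odd (inversions (word A)).
Proof.
move=> n_odd hl; have [x [u [v [-> sz _ bnd ->]]]] := word_sigma_split hl.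
rewrite -cat_cons inversions_insert_max; last first.
  by apply: sub_all bnd => a /= /andP[].
have pos s : all (fun a => 1 < a) [seq a.+1 | a <- s] = all (fun a => 0 < a) s.
  by rewrite all_map.
have {}bnd : all (fun a => 0 < a) ((x :: u) ++ v).
  by apply: sub_all bnd => a /= /andP[].
case: v sz bnd => [|y v] sz bnd.
  rewrite cats0 addn0 (inversions_insert_min (u := [::])) ?addn0.
    by rewrite inversions_succ.
  by rewrite pos -[x :: u]cats0.
rewrite inversions_insert_min -map_cat ?pos //.
rewrite inversions_succ size_map; move: n_odd sz => /=; lia.
Qed.

(** * Iterates and periods of [sigma] *)

Definition E_minus n k : {set 'S_n} :=
  [set A in E n k | head 0 (word A) < last 0 (word A)].

Lemma val_iter_ordS n l (i : 'I_n) : iter l (@ordS n) i = (i + l) %% n :> nat.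
Proof.
elim: l => [|l IH] /=; first by rewrite addn0 modn_small.
by rewrite IH -addn1 modnDml addn1 addnS.
Qed.

(** The rotation test serves as an iteration count, so that the rotations of successive steps add
    up. *)
Lemma sigmaE n k (A : 'S_n) (j : 'I_n) : A \in E_minus n k ->
  sigma A (iter (last 0 (word A) == n) (@ordS n) j) = ordS (A j).
Proof.
rewrite !inE => /andP[_ hl]; rewrite permE /sigma_fun.
case: eqP => _ /=; first by rewrite ordSK.
have [x [u [v [ew _ _ /= /andP[/andP[_ ltx] _] _]]]] := word_sigma_split hl.
by rewrite ew /= (ltn_eqF ltx).
Qed.

Lemma iter_sigma n k l (A : 'S_n) : A \in E_minus n k ->
  iter l (@sigma n) A \in E_minus n k /\
  exists m, bit_weight (ascent_bits (word (iter l (@sigma n) A))) + l =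
              bit_weight (ascent_bits (word A)) + m * (n - k) /\
            forall j, iter l (@sigma n) A (iter m (@ordS n) j) = iter l (@ordS n) (A j).
Proof.
move=> AE; elim: l => [|l [BE [m [ew eB]]]] /=; first by split=> //; exists 0.
set B := iter l _ A in BE ew eB *.
have := BE; rewrite !inE => /andP[/eqP asc hl].
have [asc' hl' ew'] := sigma_step asc hl.
split; first by rewrite asc' eqxx.
exists ((last 0 (word B) == n) + m); split; first by rewrite mulnDl; lia.
by move=> j; rewrite iterD (sigmaE _ BE) eB.
Qed.

Lemma sigma_period n k l (A : 'S_n) :
    A \in E_minus n k -> iter l (@sigma n) A = A ->
  exists m, l = m * (n - k) /\
            forall j, A (iter m (@ordS n) j) = iter l (@ordS n) (A j).
Proof.
move=> AE fixA; have [_ [m]] := iter_sigma l AE.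
by rewrite fixA => -[ew eA]; exists m; split=> //; lia.
Qed.

(** * Absence of orbits when [k] and [n / d] have a common factor *)

Lemma num_orbits_eq0 n k d (S : {set 'S_n}) :
    S \subset E_minus n k -> k < n -> 0 < d -> d %| n -> 1 < gcdn k (n %/ d) ->
  num_orbits S (d * (n - k)) = 0.
Proof.
move=> /subsetP SE ltkn d0 /dvdnP[e en] g1; apply: eq_card0 => O; rewrite !inE.
apply/negP => /andP[/imsetP[A _ ->{O}] /andP[/subsetP sub /forallP per]].
have BO : sigma A \in sigma_orbit A by apply/sigma_orbitP; exists 1.
have := per (sigma A); rewrite BO => /and3P[_ /eqP fixB _].
have BE := SE _ (sub _ BO); move: (sigma A) BE fixB => {BO} B BE fixB.
have [m [/eqP]] := sigma_period BE fixB.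
rewrite eqn_pmul2r ?subn_gt0 // => /eqP <- eB {m fixB}.
move: g1; rewrite {1}en mulnK // => g1.
have iterB i j :
    B (iter (i * d) (@ordS n) j) = iter (i * (d * (n - k))) (@ordS n) (B j).
  by elim: i => [|i IH] //; rewrite !mulSn !iterD eB IH.
have n0 : 0 < n by apply: leq_ltn_trans ltkn.
have /dvdnP[e' ee'] := dvdn_gcdr k e.
have /dvdnP[k' kk'] := dvdn_gcdl k e.
set g := gcdn k e in g1 ee' kk'.
have := iterB e' (Ordinal n0).
have -> : iter (e' * (d * (n - k))) (@ordS n) (B (Ordinal n0)) = B (Ordinal n0).
  apply: ord_inj; rewrite val_iter_ordS.
  (* From [n = e' * g * d] and [k = k' * g] follows [e' * d * k = k' * n]. *)
  have -> : e' * (d * (n - k)) = (e' * d - k') * n.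
    rewrite en ee' {1}kk'; nia.
  by rewrite addnC modnMDl modn_small.
(* Position [e' * d] would coincide with position 0, but [0 < e' * d < n] because [g > 1]. *)
move/perm_inj/(congr1 (@nat_of_ord n)); rewrite val_iter_ordS /= add0n modn_small; nia.
Qed.

(** * The permutation [P] and its translates *)

Lemma P_perm_exists n l : 0 < n -> coprime n l ->
  exists P : 'S_n, forall j : 'I_n, P j = (j * l) %% n :> nat.
Proof.
move=> n0 cnl; pose f (j : 'I_n) := Ordinal (ltn_pmod (j * l) n0).
have f_inj : injective f.
  move=> i j /(congr1 val) /=.
  wlog leij : i j / i <= j => [hw|] e.
    by case/orP: (leq_total i j) => [/hw|/hw h]; [apply|apply/esym/h].
  have : n %| (j - i) * l.
    by rewrite mulnBl -eqn_mod_dvd ?leq_mul2r ?leij ?orbT // e.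
  rewrite Gauss_dvdl // => dvd; apply: ord_inj.
  have := ltn_ord j; case: (posnP (j - i)) dvd => [|pos /(dvdn_leq pos)]; lia.
by exists (perm f_inj) => j; rewrite permE.
Qed.

Section CoprimeCase.

Variables (n k : nat) (P : 'S_n).
Hypotheses (k0 : 0 < k) (ltkn : k < n).
Hypothesis PE : forall j : 'I_n, P j = (j * (n - k)) %% n :> nat.

Let n0 : 0 < n. Proof. exact: leq_ltn_trans ltkn. Qed.
Let ltn1n : n.-1 < n. Proof. by rewrite prednK. Qed.

Lemma word_P : word P = P_word n (n - k).
Proof.
apply: (@eq_from_nth _ 0); first by rewrite size_word size_map size_iota.
move=> i; rewrite size_word => lti.
rewrite (nth_word P (Ordinal lti)) PE (nth_map 0) ?size_iota //.
by rewrite nth_iota // add0n.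
Qed.

Lemma head_last_word (A : 'S_n) :
  head 0 (word A) = (A (Ordinal n0)).+1 /\ last 0 (word A) = (A (Ordinal ltn1n)).+1.
Proof.
by split; rewrite -nth_word /= ?nth0 // -nth_last size_word.
Qed.

Lemma translate_head_last (A : 'S_n) t :
    t < n -> (forall j : 'I_n, A j = (t + j * (n - k)) %% n :> nat) ->
  head 0 (word A) = t.+1 /\ last 0 (word A) = ((t + k) %% n).+1.
Proof.
move=> ltt eA; have [-> ->] := head_last_word A.
rewrite !eA /= addn0 modn_small //; split=> //; congr _.+1.
(* Modulo [n], the last position contributes [-(n - k)], that is [k]. *)
have -> : t + n.-1 * (n - k) = (n - k).-1 * n + (t + k) by nia.
by rewrite modnMDl.
Qed.

(** None of these steps rotates: the translate by [s < n - k - 1] starts with [s + 1] and ends with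
    [s + k + 1], both below [n]. *)
Lemma iter_sigma_P t (j : 'I_n) : t < n - k ->
  iter t (@sigma n) P j = (t + j * (n - k)) %% n :> nat.
Proof.
elim: t j => [|t IH] j ltt; first by rewrite PE.
have {}IH i := IH i (ltnW ltt); rewrite iterS.
have ltn_t : t < n by lia.
have [hd lst] := translate_head_last ltn_t IH.
rewrite permE /sigma_fun hd lst modn_small; last by lia.
have -> : ((t + k).+1 == n) = false by lia.
have -> : (t.+1 == n) = false by lia.
by rewrite /= IH -addn1 modnDml addn1.
Qed.

(** The translate by [n - k - 1] ends in [n], so the last step rotates; shifting positions by one
    undoes the addition of [n - k]. *)
Lemma iter_sigma_P_id : iter (n - k) (@sigma n) P = P.
Proof.
have nk0 : 0 < n - k by rewrite subn_gt0.
have tlt : (n - k).-1 < n - k by rewrite prednK.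
have eA := fun j => iter_sigma_P j tlt.
rewrite -{1}(prednK nk0) iterS; set A := iter _ _ P in eA *.
have ltn_t : (n - k).-1 < n by lia.
have [hd lst] := translate_head_last ltn_t eA.
apply/permP => j; rewrite -[j]ord_predK; move: (ord_pred j) => {j} i; apply: ord_inj.
rewrite permE /sigma_fun lst modn_small; last by lia.
have -> : (((n - k).-1 + k).+1 == n) = true by lia.
rewrite ordSK PE /= eA -addn1 modnDml modnMml; rewrite mulSn; congr (_ %% n); lia.
Qed.

(** The ascents of [P] are not counted directly. Whatever their number [a], the return after [n - k]
    steps gives [n - k = m * (n - a)], and comparing positions 0 and 1 gives [m = 1] modulo [n]. *)
Lemma P_in_E_minus : P \in E_minus n k.
Proof.
have P0 : forall j : 'I_n, P j = (0 + j * (n - k)) %% n :> nat by [].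
have [hd lst] := translate_head_last n0 P0.
have PE' : P \in E_minus n (ascents (word P)).
  by rewrite !inE eqxx hd lst modn_small.
have [m [em eP]] := sigma_period PE' iter_sigma_P_id.
have lt1n : 1 < n by lia.
have m1 : m %% n = 1.
  have /(congr1 (@nat_of_ord n)) := eP (Ordinal n0).
  rewrite val_iter_ordS (PE (Ordinal n0)) /= mul0n mod0n add0n modn_small; last by lia.
  have -> : n - k = P (Ordinal lt1n) by rewrite PE /= mul1n modn_small //; lia.
  by move/ord_inj/perm_inj/(congr1 (@nat_of_ord n)); rewrite val_iter_ordS.
have asc : ascents (word P) = k.
  (* If [m >= n], then [m * (n - a)] is 0 or at least [n], hence not [n - k]. *)
  move: m1 em; case: (ltnP m n) => [ltm|lem]; first by rewrite modn_small // => ->; lia.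
  by case: (posnP (n - ascents (word P))) => [->|]; nia.
by move: PE'; rewrite asc.
Qed.

(** * Orbits of period [n - k] *)

Lemma period_iter_sigma_P (A : 'S_n) :
    A \in E_minus n k -> iter (n - k) (@sigma n) A = A ->
  exists2 t, t < n - k & A = iter t (@sigma n) P.
Proof.
move=> AE fixA; have [m [/eqP]] := sigma_period AE fixA.
rewrite -{1}[n - k]mul1n eqn_pmul2r ?subn_gt0 // => /eqP <- eA {m}.
have step (j : nat) (ltj : j < n) :
    A (Ordinal ltj) = (A (Ordinal n0) + j * (n - k)) %% n :> nat.
  elim: j ltj => [|j IH] ltj.
    by rewrite addn0 modn_small //; congr (nat_of_ord (A _)); apply: val_inj.
  have -> : Ordinal ltj = ordS (Ordinal (ltnW ltj)).
    by apply: ord_inj; rewrite /= modn_small.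
  by rewrite (eA (Ordinal (ltnW ltj))) val_iter_ordS IH modnDml mulSn; congr (_ %% n); lia.
have tr (j : 'I_n) : A j = (A (Ordinal n0) + j * (n - k)) %% n :> nat.
  by case: j => j ltj; exact: step.
(* A translate by [t >= n - k] wraps around at its last letter, which then lies below the first. *)
have ltt : A (Ordinal n0) < n - k.
  have := AE; rewrite !inE => /andP[_].
  have [-> ->] := translate_head_last (ltn_ord _) tr.
  have := ltn_ord (A (Ordinal n0)); case: (ltnP (A (Ordinal n0)) (n - k)) => // le lt.
  have -> : A (Ordinal n0) + k = 1 * n + (A (Ordinal n0) + k - n) by lia.
  by rewrite modnMDl modn_small; lia.
by exists (A (Ordinal n0)) => //; apply/permP => j; apply: ord_inj; rewrite iter_sigma_P // tr.
Qed.

(** Every counted orbit consists of iterates of [P] and contains [P], so it is the orbit of [P].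
    Conversely, stability puts that orbit inside [S] as soon as [P] is in [S]. *)
Lemma num_orbits_period_1 (S : {set 'S_n}) :
    S \subset E_minus n k -> (forall A, A \in S -> sigma A \in S) ->
  num_orbits S (n - k) = (P \in S).
Proof.
move=> /subsetP SE Sstable; have nk0 : 0 < n - k by rewrite subn_gt0.
have fix_iter j : iter (n - k) (@sigma n) (iter j (@sigma n) P) = iter j (@sigma n) P.
  by rewrite -iterD addnC iterD iter_sigma_P_id.
have PO : P \in sigma_orbit P.
  by apply/sigma_orbitP; exists (n - k); rewrite ?iter_sigma_P_id.
have orbitE O : O \in [set sigma_orbit A | A : 'S_n] -> O \subset S ->
    [forall A in O, has_period A (n - k)] -> O = sigma_orbit P.
  case/imsetP=> A0 _ ->{O} /subsetP sub /forallP per.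
  have Oiter B : B \in sigma_orbit A0 -> exists2 t, t < n - k & B = iter t (@sigma n) P.
    move=> BO; apply: period_iter_sigma_P; first exact/SE/sub.
    by have := per B; rewrite BO => /and3P[_ /eqP].
  have PO0 : P \in sigma_orbit A0.
    have BO : sigma A0 \in sigma_orbit A0 by apply/sigma_orbitP; exists 1.
    have [t ltt eB] := Oiter _ BO.
    (* One step leads from [A0] to [sigma A0], the [t]-th iterate of [P]; [n - k - t] more steps
       return to [P]. *)
    apply/sigma_orbitP; exists (n - k - t + 1); first by rewrite addn1.
    by rewrite iterD /= eB -iterD subnK ?iter_sigma_P_id // ltnW.
  apply/setP => B; apply/idP/idP => [/Oiter[t _ ->]|/sigma_orbitP[j j0 ->]].
    (* Adding a full period makes the exponent positive even for [t = 0]. *)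
    by apply/sigma_orbitP; exists (t + (n - k)); rewrite ?iterD ?iter_sigma_P_id //; lia.
  case/sigma_orbitP: PO0 => i i0 eP; apply/sigma_orbitP; exists (j + i); first by lia.
  by rewrite iterD -eP.
rewrite /num_orbits; case: (boolP (P \in S)) => PS.
  apply/eqP/cards1P; exists (sigma_orbit P); apply/setP => O; rewrite !inE.
  apply/idP/eqP => [/and3P[]|->{O}]; first exact: orbitE.
  rewrite imset_f //=; apply/andP; split.
    apply/subsetP => _ /sigma_orbitP[j _ ->].
    by elim: j => //= j; apply: Sstable.
  apply/forallP => B; apply/implyP => /sigma_orbitP[j _ eB].
  have BE : B \in E_minus n k by rewrite eB; case: (iter_sigma j P_in_E_minus).
  rewrite /has_period nk0 {1 2}eB fix_iter eqxx /=.
  apply/forallP => m; apply/implyP => m0; apply/eqP => fixB.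
  (* Minimality: every return time is a multiple of [n - k]. *)
  have [q [em _]] := sigma_period BE fixB.
  have := ltn_ord m; rewrite em -{2}[n - k]mul1n ltn_pmul2r // ltnS leqn0 => /eqP q0.
  by move: m0; rewrite em q0.
apply: eq_card0 => O; rewrite !inE; apply/negP => /and3P[Oorb sub per].
by move: PS; rewrite (subsetP sub) // (orbitE O Oorb sub per).
Qed.

End CoprimeCase.

Theorem theorem5p1 (n k : nat) (n_odd : odd n) (k_range : 1 <= k <= n - 1) :
  (forall d : nat, 0 < d -> d %| n -> 1 < gcdn k (n %/ d) ->
     alpha n k d = 0 /\ gamma n k d = 0)
  /\
  (gcdn k n = 1 ->
     alpha n k 1 = epsilon n (n - k) /\ gamma n k 1 = 1 - epsilon n (n - k)).
Proof.
have /andP[k0 lekn1] := k_range.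
have n0 : 0 < n by case: n n_odd {k_range lekn1}.
have ltkn : k < n by lia.
have Ee_sub : E_e_minus n k \subset E_minus n k.
  by apply/subsetP => A; rewrite !inE => /andP[/andP[-> _] ->].
have Eo_sub : E_o_minus n k \subset E_minus n k.
  by apply/subsetP => A; rewrite !inE => /andP[/andP[-> _] ->].
split=> [d d0 dn g1|cop]; first by split; apply: num_orbits_eq0.
have cnk : coprime n (n - k).
  rewrite coprime_sym /coprime -{2}(subnK (ltnW ltkn)) gcdnDl gcdnC -gcdnDr.
  by rewrite subnK ?cop // ltnW.
have [P PE] := P_perm_exists n0 cnk.
have := P_in_E_minus k0 ltkn PE; rewrite !inE => /andP[ascP hlP].
rewrite /alpha /gamma mul1n !(num_orbits_period_1 k0 ltkn PE) //.
  by rewrite !inE ascP hlP /epsilon -(word_P PE); case: (odd _).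
all: move=> A; rewrite !inE => /andP[/andP[/eqP asc oddA] hl].
all: have [-> -> _] := sigma_step asc hl.
all: by rewrite eqxx odd_inversions_sigma ?oddA.
Qed.
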